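(* Let $m\ge1$, let $f=\sum_{|\alpha|\ge1}a_\alpha X_\alpha$ be a positive regular free holomorphic function and let $\mathcal P$ be a family of noncommutative polynomials. Let $A=(A_1,\dots,A_n)\in B(\mathcal H)^n$ be such that $\sum_{|\alpha|\ge1}a_\alpha A_\alpha A_\alpha^*$ is convergent in the weak operator topology and $p(A_1,\dots,A_n)=0$ for all $p\in\mathcal P$. If $$\Phi_{f,A}^\infty(I):=\text{SOT-}\lim_{k\to\infty}\Phi_{f,A}^k(I)$$ exists, then the following statements are equivalent: (i) $\Phi_{f,A}^\infty(I)$ is invertible; (ii) there exist $T=(T_1,\dots,T_n)\in\mathcal V^m_{f,\mathcal P}(\mathcal H)$ such that $(id-\Phi_{f,T})^m(I)=0$ and an invertible operator $Y\in B(\mathcal H)$ such that $$A_i=Y^{-1}T_iY,\qquad i=1,\dots,n.$$ In the particular case when $\Phi_{f,A}(I)\le I$, the limit $\text{SOT-}\lim_{k\to\infty}\Phi_{f,A}^k(I)$ always exists.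
   Context: Let $n\in\mathbb N=\{1,2,\dots\}$. $\mathbb F_n^+$ is the unital free semigroup on generators $g_1,\dots,g_n$ with identity $g_0$; $|\alpha|$ is the word length ($|g_0|=0$). For $X=(X_1,\dots,X_n)\in B(\mathcal H)^n$ ($\mathcal H$ a complex Hilbert space) put $X_\alpha=X_{i_1}\cdots X_{i_k}$ if $\alpha=g_{i_1}\cdots g_{i_k}$ and $X_{g_0}=I$. A positive regular free holomorphic function is a formal series $f=\sum_{\alpha\in\mathbb F_n^+}a_\alpha X_\alpha$ in noncommuting variables with $\limsup_{k\to\infty}(\sum_{|\alpha|=k}|a_\alpha|^2)^{1/2k}<\infty$, $a_\alpha\ge 0$ for all $\alpha$, $a_{g_0}=0$, and $a_{g_i}>0$ for $i=1,\dots,n$. Whenever $\sum_{|\alpha|\ge1}a_\alpha X_\alpha X_\alpha^*$ converges in the weak operator topology (WOT), $\Phi_{f,X}(Y)=\sum_{|\alpha|\ge1}a_\alpha X_\alpha YX_\alpha^*$ for $Y\in B(\mathcal H)$ (WOT convergence). $id$ is the identity map on $B(\mathcal H)$; SOT is the strong operator topology. $\mathbf D_f^m(\mathcal H)$ is the set of $X\in B(\mathcal H)^n$ (with the series above WOT convergent) such that $(id-\Phi_{f,X})^s(I)\ge 0$ for $s=1,\dots,m$, and $\mathcal V^m_{f,\mathcal P}(\mathcal H)=\{X\in\mathbf D_f^m(\mathcal H): p(X_1,\dots,X_n)=0\ \forall p\in\mathcal P\}$. *)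

(* Defs.v *)
From HB Require Import structures.
From mathcomp Require Import all_boot all_order all_algebra.
From mathcomp Require Import finmap complex.
From mathcomp Require Import(canonicals, coercions) monalg.
From mathcomp Require Import boolp classical_sets functions reals ereal.
From mathcomp Require Import topology normedtype sequences exp.

Set Implicit Arguments.
Unset Strict Implicit.
Unset Printing Implicit Defensive.

Import Order.TTheory GRing.Theory Num.Theory.
Import numFieldNormedType.Exports.

Local Open Scope classical_set_scope.
Local Open Scope ring_scope.
Local Open Scope complex_scope.

(* The norm of a normed module over [R[i]] is itself [R[i]]-valued. The inner
   product is linear in its first argument, conjugate-linear in the second. *)
HB.mixin Record CompleteNormedModule_isHilbert (R : realType) H
    of CompleteNormedModule R[i] H := {
  inner : {dot H for Num.conj} ;
  inner_norm : forall x : H, inner x x = `|x| ^+ 2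
}.

#[short(type="hilbertType")]
HB.structure Definition Hilbert (R : realType) :=
  {H of CompleteNormedModule_isHilbert R H & CompleteNormedModule R[i] H}.

Section BoundedOperators.
Context {R : realType} (H : hilbertType R).

(* A linear map between normed spaces is bounded iff it is continuous
   ([linear_bounded_continuous]). *)
Definition bounded_linear : pred (H -> H) :=
  fun T => `[< linear T /\ continuous T >].

Record bop : predArgType := Bop { bop_fun :> H -> H ; _ : bounded_linear bop_fun }.

HB.instance Definition _ := [isSub for bop_fun].
HB.instance Definition _ := [Choice of bop by <:].

Lemma bopP (T : bop) : linear T /\ continuous T.
Proof. by case: T => T /= /asboolP. Qed.

Lemma bounded_linear_submod : submod_closed bounded_linear.
Proof.
split=> [|k S T /asboolP[lS cS] /asboolP[lT cT]]; apply/asboolP; split.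
- by move=> c x y; rewrite /= scaler0 addr0.
- by move=> x; exact: cvg_cst.
- move=> c x y; rewrite !fctE lS lT !scalerDr !scalerA (mulrC k c).
  by rewrite -!addrA; congr (_ + _); rewrite addrCA.
- by move=> x; apply: cvgD; [apply: cvgZr; exact: cS|exact: cT].
Qed.

HB.instance Definition _ := GRing.SubChoice_isSubLmodule.Build
  R[i] (H -> H) bounded_linear bop bounded_linear_submod.

Lemma bop_one_subproof : bounded_linear idfun.
Proof. by apply/asboolP; split=> // x; exact: cvg_id. Qed.

Lemma bop_mul_subproof (S T : bop) : bounded_linear (S \o T).
Proof.
have [[lS cS] [lT cT]] := (bopP S, bopP T).
apply/asboolP; split=> [c x y|x]; first by rewrite /= lT lS.
by apply: continuous_comp; [exact: cT|exact: cS].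
Qed.

Definition bop_one := Bop bop_one_subproof.
Definition bop_mul (S T : bop) := Bop (bop_mul_subproof S T).

Lemma bop_mulA : associative bop_mul.
Proof. by move=> S T U; apply: val_inj. Qed.
Lemma bop_1mul : left_id bop_one bop_mul.
Proof. by move=> T; apply: val_inj. Qed.
Lemma bop_mul1 : right_id bop_one bop_mul.
Proof. by move=> T; apply: val_inj. Qed.
Lemma bop_mulDl : left_distributive bop_mul +%R.
Proof. by move=> S T U; apply: val_inj. Qed.
Lemma bop_mulDr : right_distributive bop_mul +%R.
Proof.
move=> S T U; apply: val_inj; apply: funext => x /=.
by have [lS _] := bopP S; have := lS 1 (T x) (U x); rewrite !scale1r.
Qed.

(* Possibly trivial ring: [H] may be the zero space. *)
HB.instance Definition _ := GRing.Zmodule_isPzRing.Build bop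
  bop_mulA bop_1mul bop_mul1 bop_mulDl bop_mulDr.

Definition is_inverse (S T : bop) := S * T = 1 /\ T * S = 1.
Definition invertible (T : bop) := exists S, is_inverse S T.

(* The default value of [xget] is never used: every bounded operator on a
   Hilbert space has a (unique) adjoint. *)
Definition adjoint (T : bop) : bop :=
  xget 0 [set S : bop | forall x y : H, inner (T x) y = inner x (S y)].

(* On [R[i]], [0 <= z] says that [z] is a nonnegative real. *)
Definition op_ge0 (T : bop) := forall x : H, 0 <= inner (T x) x.
Definition op_le (S T : bop) := op_ge0 (T - S).

Definition wot_cvg (T_ : nat -> bop) (T : bop) := forall x y : H,
  (fun k => inner (T_ k x) y : R[i]^o) @ \oo --> (inner (T x) y : R[i]^o).
Definition sot_cvg (T_ : nat -> bop) (T : bop) := forall x : H,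
  (fun k => T_ k x) @ \oo --> T x.

End BoundedOperators.

Section FreeHolomorphic.
Context {R : realType} {n : nat}.

(* Formal power series in [n] noncommuting variables with real coefficients are
   given by their coefficient families; a word is a sequence of letters and
   the identity of the free semigroup is the empty one. *)
Definition positive_regular_free_holomorphic (a : seq 'I_n -> R) :=
  [/\ (limn_esup (fun k =>
         ((\sum_(w : k.-tuple 'I_n) `|a w| ^+ 2) `^ ((2 * k)%N%:R)^-1)%:E)
         < +oo)%E,
      forall w, 0 <= a w,
      a [::] = 0 &
      forall i, 0 < a [:: i]].

Context {H : hilbertType R}.
Implicit Types (a : seq 'I_n -> R) (X : 'I_n -> bop H) (Y : bop H).

Definition opword X (w : seq 'I_n) : bop H := \prod_(i <- w) X i.

(* [{malg R[i][{fmonom 'I_n}]}] is the free unital algebra on [n] generators. *)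
Definition nc_poly := monalg.malg (monalg.fmonom 'I_n) R[i].

Definition nc_eval (p : nc_poly) X : bop H :=
  \sum_(w <- monalg.msupp p) monalg.mcoeff w p *: opword X w.

(* The series over nonempty words is summed by increasing word length; the
   [N]-th partial sum runs over the words of length [1, ..., N]. *)
Definition Phi_partial a X Y (N : nat) : bop H :=
  \sum_(1 <= k < N.+1) \sum_(w : k.-tuple 'I_n)
    (a w)%:C *: (opword X w * Y * adjoint (opword X w)).

Definition Phi_defined a X := exists Z : bop H, wot_cvg (Phi_partial a X 1) Z.

(* When [a >= 0], [Phi_defined a X] makes the series WOT convergent for every
   [Y], so that the default value of [xget] is not used. *)
Definition Phi a X Y : bop H := xget 0 [set Z | wot_cvg (Phi_partial a X Y) Z].

Definition defect a X (s : nat) : bop H := iter s (fun Y => Y - Phi a X Y) 1.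

Definition noncomm_domain a (m : nat) : set ('I_n -> bop H) :=
  [set X | Phi_defined a X /\
           forall s, (1 <= s <= m)%N -> op_ge0 (defect a X s)].

Definition noncomm_variety a (P : set nc_poly) (m : nat) :
    set ('I_n -> bop H) :=
  [set X | noncomm_domain a m X /\ forall p, P p -> nc_eval p X = 0].

End FreeHolomorphic.

Arguments nc_poly : clear implicits.

(* Main.v *)
Require Import Defs.
From HB Require Import structures.
From mathcomp Require Import all_boot all_order all_algebra.
From mathcomp Require Import complex lra ring.
From mathcomp Require Import boolp classical_sets reals interval_inference.
From mathcomp Require Import topology normedtype sequences.

(** Write Phi_A for the map Y |-> sum of a_w A_w Y A_w^* over the nonempty
    words w. The argument is that similarity transports fixed points: if
    A_i = U T_i V with V = U^-1, then Phi_A(W) = U Phi_T(V W V^* ) U^*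
    ([Phi_conj]). So T = Q^(-1/2) A Q^(1/2) satisfies Phi_T(I) = I exactly when
    Phi_A(Q) = Q, and then every defect (id - Phi_T)^s(I) with s >= 1 vanishes.

    (i) => (ii). The limit Q of the iterates Phi_A^k(I) must be shown to be
    fixed ([Phi_limit_fixed]); this is a matter of exchanging two limits, as
    Phi_A is itself a weak limit of finite sums. On positive operators Fatou's
    lemma holds ([Phi_fatou]) and gives Phi_A(Q) <= Q. Now invertibility enters:
    I <= c Q for some c, hence Phi_A^k(I) <= c Q for all k, and Fatou's lemma
    for the positive operators c Q - Phi_A^k(I) gives the reverse inequality.

    (ii) => (i). If all defects D_s = (id - Phi_T)^s(I), s <= m, are positive
    and D_m = 0, then D_(m-1) is a fixed point of Phi_T, and it is the difference
    D_(m-2) - Phi_T(D_(m-2)). Iterating, Phi_T^N(D_(m-2)) = D_(m-2) - N D_(m-1)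
    remains positive for every N, which forces D_(m-1) = 0
    ([defect_fixed_eq0]). Descending to s = 1 yields Phi_T(I) = I. Then
    G = Y^-1 (Y^-1)^* is an invertible positive fixed point of Phi_A, and
    G <= c I gives G <= c Phi_A^k(I), so that G <= c Q: the limit Q is bounded
    below, hence invertible.

    When Phi_A(I) <= I the iterates decrease, and a decreasing sequence of
    positive operators converges strongly ([nonincreasing_sot_cvg]).

    All values of Phi that occur are taken at positive operators W, where the
    partial sums increase and are dominated by a multiple of those at I, so
    that the same monotone convergence theorem shows that the series converges
    ([Phi_cvg]). The Hilbert space theory rests on one variational argument,
    the Lax-Milgram theorem [lax_milgram]: it provides adjoints (Riesz
    representation) and inverses of operators that are bounded below. *)

Set Implicit Arguments.
Unset Strict Implicit.
Unset Printing Implicit Defensive.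

Import Order.TTheory GRing.Theory Num.Theory.
Import numFieldNormedType.Exports.

Local Open Scope classical_set_scope.
Local Open Scope ring_scope.
Local Open Scope complex_scope.

Local Notation Re := complex.Re.

(** * Inner products and bounded operators *)

HB.instance Definition _ (R : realType) (H : hilbertType R) (T : bop H) :=
  GRing.isLinear.Build R[i] H H *:%R (bop_fun T) (proj1 (bopP T)).

Section Inner.
Context {R : realType} {H : hilbertType R}.
Implicit Types (x y z : H) (S T : bop H).

Lemma innerDl x y z : inner (x + y) z = inner x z + inner y z.
Proof. exact: linearDl. Qed.
Lemma innerDr x y z : inner x (y + z) = inner x y + inner x z.
Proof. exact: linearDr. Qed.
Lemma innerBl x y z : inner (x - y) z = inner x z - inner y z.
Proof. exact: linearBl. Qed.
Lemma innerBr x y z : inner x (y - z) = inner x y - inner x z.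
Proof. exact: linearBr. Qed.
Lemma innerZl c x y : inner (c *: x) y = c * inner x y.
Proof. exact: linearZl_LR. Qed.
Lemma innerZr c x y : inner x (c *: y) = Num.conj c * inner x y.
Proof. exact: linearZr_LR. Qed.
Lemma inner0l x : inner 0 x = 0. Proof. exact: linear0l. Qed.
Lemma inner0r x : inner x 0 = 0. Proof. exact: linear0r. Qed.

Lemma inner_conj x y : inner x y = Num.conj (inner y x).
Proof. by rewrite hermC expr0 mul1r. Qed.

Lemma inner_normE x : inner x x = `|x| ^+ 2. Proof. exact: inner_norm. Qed.

Lemma inner_ge0 x : 0 <= inner x x.
Proof. by rewrite inner_norm exprn_ge0. Qed.

(** Cauchy-Schwarz, by splitting x orthogonally along y. *)
Lemma inner_bound x y : `|inner x y| <= `|x| * `|y|.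
Proof.
have [->|y0] := eqVneq y 0; first by rewrite inner0r normr0 normr0 mulr0.
rewrite -ler_sqr ?nnegrE ?mulr_ge0 // exprMn -!inner_norm.
pose a := inner x y / inner y y; pose u := x - a *: y.
have uy : inner u y = 0.
  by rewrite innerBl innerZl divfK ?dnorm_eq0 // subrr.
have -> : inner x y = a * inner y y by rewrite divfK ?dnorm_eq0.
have -> : x = u + a *: y by rewrite subrK.
rewrite hnormDd /=; last by rewrite innerZr uy mulr0.
rewrite dnormZ normrM (ger0_norm (inner_ge0 y)) exprMn mulrDl.
by rewrite -(mulrA (`|a| ^+ 2)) -expr2 lerDr mulr_ge0 ?inner_ge0.
Qed.

Lemma bopDE S T x : (S + T) x = S x + T x. Proof. by []. Qed.
Lemma bopBE S T x : (S - T) x = S x - T x. Proof. by []. Qed.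
Lemma bopZE c T x : (c *: T) x = c *: T x. Proof. by []. Qed.
Lemma bopME S T x : (S * T) x = S (T x). Proof. by []. Qed.
Lemma bop1E x : (1 : bop H) x = x. Proof. by []. Qed.
Lemma bop0E x : (0 : bop H) x = 0. Proof. by []. Qed.

Lemma bopD T x y : T (x + y) = T x + T y. Proof. exact: linearD. Qed.
Lemma bopB T x y : T (x - y) = T x - T y. Proof. exact: linearB. Qed.
Lemma bopZ T c x : T (c *: x) = c *: T x. Proof. exact: linearZ. Qed.

Definition self_adjoint T := forall x y, inner (T x) y = inner x (T y).

(** Polarization: the sesquilinear form <Tx,y> - <x,Ty> vanishes on the diagonal
    because <Tx,x> is real, hence it is alternating; comparing its values at
    y and at iy shows that it is also symmetric, so it is zero. *)
Lemma op_ge0_self_adjoint T : op_ge0 T -> self_adjoint T.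
Proof.
move=> T0 x y; apply/eqP; rewrite -subr_eq0; apply/eqP.
pose s u v := inner (T u) v - inner u (T v).
have s0 u : s u u = 0.
  by rewrite /s (inner_conj u) (CrealP (ger0_real (T0 u))) subrr.
have sD u v u' v' : s (u + u') (v + v') = s u v + s u v' + s u' v + s u' v'.
  by rewrite /s !bopD !innerDl !innerDr; ring.
have sZ u v : s ('i *: u) v = 'i * s u v.
  by rewrite /s bopZ !innerZl mulrBr.
have sZr u v : s u ('i *: v) = - 'i * s u v.
  by rewrite /s bopZ !innerZr mulrBr conjCi.
have H1 : s x y + s y x = 0.
  by have := sD x x y y; rewrite !s0 addr0 add0r => <-.
have H2 : s x y = s y x.
  have := sD x x ('i *: y) ('i *: y); rewrite !s0 addr0 add0r sZ sZr => /esym/eqP.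
  by rewrite mulNr addrC subr_eq0 => /eqP/(mulfI (neq0Ci _)) ->.
by move: H1; rewrite -H2 -mulr2n => /eqP; rewrite mulrn_eq0 /= => /eqP.
Qed.

Lemma eq_inner x y : (forall z, inner x z = inner y z) -> x = y.
Proof.
move=> xy; apply/eqP; rewrite -subr_eq0 -normr_eq0 -sqrf_eq0 -inner_norm.
by rewrite innerBl xy subrr.
Qed.

Lemma eq_inner_r x y : (forall z, inner z x = inner z y) -> x = y.
Proof. by move=> xy; apply: eq_inner => z; rewrite inner_conj xy -inner_conj. Qed.

Lemma bop_eqP S T : (forall x, S x = T x) -> S = T.
Proof. by move=> ST; apply: val_inj; apply: funext. Qed.

Lemma bopZAl (c : R[i]) S T : (c *: S) * T = c *: (S * T).
Proof. exact: bop_eqP. Qed.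
Lemma bopZAr (c : R[i]) S T : S * (c *: T) = c *: (S * T).
Proof. by apply: bop_eqP => x; rewrite bopME bopZE bopZ. Qed.

Lemma bop_bounded T : exists2 M : R[i], 0 < M & forall x, `|T x| <= M * `|x|.
Proof.
have [lT cT] := bopP T.
have /linear_bounded_continuous/linear_boundedP/pinfty_ex_gt0 [M M0 hM] :
   continuous (T : {linear H -> H}) := cT.
by exists M.
Qed.

End Inner.

(** * Strong and weak limits *)

Lemma cvg_lipschitz {R : realType} {V W : normedModType R[i]} {I : Type}
    (F : set_system I) {FF : Filter F} (u : I -> V) x (f : I -> W) l (M : R[i]) :
  0 <= M -> (forall k, `|l - f k| <= M * `|x - u k|) ->
  u @ F --> x -> f @ F --> l.
Proof.
move=> M0 fM ux; apply/cvgrPdist_lt => e e0.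
have M1 : 0 < M + 1 by rewrite ltr_wpDl.
have /cvgrPdist_lt/(_ (e / (M + 1)) (divr_gt0 e0 M1)) := ux.
apply: filterS => k; rewrite ltr_pdivlMr // => /(le_lt_trans _); apply.
by rewrite (le_trans (fM k)) // mulrC ler_wpM2l // lerDl.
Qed.

Section Limits.
Context {R : realType} {H : hilbertType R}.
Implicit Types (x y z : H) (S T : bop H) (u : nat -> H).

Lemma inner_cvgl u x y : u @ \oo --> x ->
  (fun k => inner (u k) y : R[i]^o) @ \oo --> (inner x y : R[i]^o).
Proof.
apply: (cvg_lipschitz (M := `|y|)) => // k.
by rewrite -innerBl mulrC inner_bound.
Qed.

Lemma sot_wot (T_ : nat -> bop H) T : sot_cvg T_ T -> wot_cvg T_ T.
Proof. by move=> TT x y; exact: inner_cvgl. Qed.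

Lemma wot_unique (T_ : nat -> bop H) S T : wot_cvg T_ S -> wot_cvg T_ T -> S = T.
Proof.
move=> TS TT; apply: bop_eqP => x; apply: eq_inner => y.
exact: (cvg_unique _ (TS x y) (TT x y)).
Qed.

(** A nonnegative complex number is its own modulus, and the modulus is
    continuous. *)
Lemma complex_limit_ge0 (z_ : nat -> R[i]^o) (z : R[i]^o) :
  (forall k, (0 : R[i]) <= z_ k) -> z_ @ \oo --> z -> (0 : R[i]) <= z.
Proof.
move=> z0 zz; have : (fun k => `|z_ k| : R[i]^o) @ \oo --> (`|z| : R[i]^o).
  exact: cvg_norm.
rewrite (_ : (fun k => _) = z_); last by apply/funext => k; rewrite ger0_norm.
by move=> /(cvg_unique _ zz) ->.
Qed.

Lemma wot_op_ge0 (T_ : nat -> bop H) T : (forall k, op_ge0 (T_ k)) ->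
  wot_cvg T_ T -> op_ge0 T.
Proof. by move=> T0 TT x; apply: complex_limit_ge0 (TT x x) => k; exact: T0. Qed.

End Limits.

(** * Real parts *)

Section ComplexReal.
Context {R : realType}.
Implicit Types (x y z : R[i]).

Lemma ReD x y : Re (x + y) = Re x + Re y. Proof. by case: x => a b; case: y => c d. Qed.
Lemma ReN x : Re (- x) = - Re x. Proof. by case: x. Qed.
Lemma Re_conj x : Re (Num.conj x) = Re x. Proof. by case: x. Qed.
Lemma Re_mulC (c : R) x : Re (c%:C * x) = c * Re x.
Proof. by case: x => a b /=; rewrite mul0r subr0. Qed.
Lemma ge0_ReK x : 0 <= x -> (Re x)%:C = x.
Proof. by move=> /ger0_real/RRe_real. Qed.
Lemma Re_le x y : x <= y -> Re x <= Re y.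
Proof. by rewrite lecE => /andP[]. Qed.
Lemma Re_lt x y : x < y -> Re x < Re y.
Proof. by rewrite ltcE => /andP[]. Qed.
Lemma Re_norm x : Re x <= Re `|x|.
Proof.
by apply: le_trans (ler_norm _) _; have /Re_le := normc_ge_Re x.
Qed.

End ComplexReal.

(** * The Lax-Milgram theorem *)

Section Complete.
Context {R : realType} {H : hilbertType R}.
Implicit Types (x y z : H) (S T : bop H).

Lemma cauchy_sqnorm_cvg (x_ : nat -> H) :
  (forall e : R, 0 < e -> exists N, forall m n, (N <= m)%N -> (N <= n)%N ->
     `|x_ m - x_ n| ^+ 2 <= e%:C) ->
  cvg (x_ @ \oo).
Proof.
move=> xc; apply/cauchy_cvgP/cauchy_ballP => e e0; rewrite near_map2.
have eE := ge0_ReK (ltW e0); have re0 : 0 < Re e by have := Re_lt e0.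
have [N hN] := xc (Re e ^+ 2 / 2) (divr_gt0 (exprn_gt0 2 re0) (ltr0n R 2)).
exists ([set n | (N <= n)%N], [set n | (N <= n)%N]); first by split; exists N.
move=> [m n] [/= Nm Nn]; rewrite -ball_normE /=.
rewrite -ltr_sqr ?nnegrE ?(ltW e0) //; apply: le_lt_trans (hN m n Nm Nn) _.
rewrite -{2}eE -rmorphXn /= ltcR ltr_pdivrMr ?ltr0n //.
by rewrite mulr_natr mulr2n ltrDl exprn_gt0.
Qed.

(** Variational proof. The real functional J(x) = <Tx,x> - 2 Re f(x) is bounded
    below, because <Tx,x> dominates a multiple of |x|^2. By the parallelogram
    identity a minimising sequence is Cauchy, and the derivative of J at its
    limit z, namely h |-> 2 Re (<h,Tz> - f(h)), has to vanish. *)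
Lemma lax_milgram T (d M : R[i]) (f : H -> R[i]) :
  (forall x y, f (x + y) = f x + f y) -> (forall c x, f (c *: x) = c * f x) ->
  0 < d -> 0 <= M ->
  (forall x, `|f x| <= M * `|x|) ->
  self_adjoint T -> (forall x, d * `|x| ^+ 2 <= inner (T x) x) ->
  exists z, forall x, f x = inner x (T z).
Proof.
move=> fD fZ d0 M0 fM Ts Td.
pose r x := Re (inner (T x) x); pose w u h := inner h (T u) - f h.
pose J x := r x - 2 * Re (f x).
have rE x : inner (T x) x = (r x)%:C.
  by rewrite ge0_ReK // (le_trans _ (Td x)) // mulr_ge0 ?exprn_ge0 ?(ltW d0).
have JD u h : J (u + h) = J u + 2 * Re (w u h) + r h.
  rewrite /J /r /w bopD !innerDl !innerDr fD !ReD ReN (inner_conj (T u) h).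
  by rewrite Re_conj (Ts h u); ring.
have rd x : Re d * Re `|x| ^+ 2 <= r x.
  have /Re_le := Td x; rewrite -(ge0_ReK (ltW d0)) -(ge0_ReK (normr_ge0 x)).
  by rewrite -rmorphXn Re_mulC.
have d0' : 0 < Re d by have := Re_lt d0.
have r0 x : 0 <= r x by apply: le_trans (rd x); rewrite mulr_ge0 ?sqr_ge0 // ltW.
have Jlb x : - (Re M ^+ 2 / Re d) <= J x.
  have Rf : Re (f x) <= Re M * Re `|x|.
    apply: le_trans (Re_norm _) _; have /Re_le := fM x.
    by rewrite -(ge0_ReK M0) Re_mulC.
  have := rd x; set n := Re `|x| in Rf *; rewrite /J => rdx.
  have : 0 <= Re d * (n - Re M / Re d) ^+ 2 by rewrite mulr_ge0 ?sqr_ge0 // ltW.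
  have -> : Re d * (n - Re M / Re d) ^+ 2 =
      Re d * n ^+ 2 - 2 * (Re M * n) + Re M ^+ 2 / Re d.
    by field; rewrite gt_eqF.
  by lra.
pose D := inf (range J).
have infJ : has_inf (range J).
  split; first by exists (J 0), 0.
  by exists (- (Re M ^+ 2 / Re d)) => _ [x _ <-].
have DJ x : D <= J x by apply: ge_inf; [exact: infJ.2|exists x].
have /choice [x_ hx] : forall n, exists x, J x < D + n.+1%:R^-1.
  move=> n; have [_ [x _ <-] hx] := @inf_adherent _ (range J) n.+1%:R^-1
    ltac:(by rewrite invr_gt0 ltr0n) infJ.
  by exists x.
have wZ u c h : w u (c *: h) = c * w u h by rewrite /w innerZl fZ mulrBr.
have rZ c h : inner (T (c *: h)) (c *: h) = `|c| ^+ 2 * inner (T h) h.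
  by rewrite bopZ innerZl innerZr normCK mulrA.
(* the parallelogram identity, by expanding J at the midpoint of u and v *)
have Jmid u v : r (u - v) <= 2 * (J u + J v - 2 * D).
  have := DJ (v + (2^-1)%:C *: (u - v)); have := JD v (u - v).
  rewrite addrC subrK JD wZ Re_mulC /r rZ rE.
  rewrite ger0_norm ?lecR ?invr_ge0 // -rmorphXn Re_mulC /=.
  move: (Re _) => W; move: (r _) => q; lra.
have cx : cvg (x_ @ \oo).
  apply: cauchy_sqnorm_cvg => e e0.
  have de0 : 0 < Re d * e / 4 by rewrite divr_gt0 ?mulr_gt0.
  have [N _ hN] := near_infty_natSinv_lt (PosNum de0).
  exists N => m n Nm Nn.
  rewrite -(ge0_ReK (normr_ge0 _)) -rmorphXn lecR -(ler_pM2l d0').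
  apply: le_trans (rd _) _; apply: le_trans (Jmid _ _) _.
  have := hN _ Nm; have := hN _ Nn; have := hx m; have := hx n; rewrite /=.
  move: (n.+1%:R^-1) (m.+1%:R^-1) (Re d * e) => p q k; lra.
exists (limn x_) => h; apply/esym/eqP; rewrite -subr_eq0; apply/eqP.
(* If J(x_n) is within eps of the infimum, then no direction decreases J by more
   than eps; a nearly optimal multiple c of h gives
   |<h,T x_n> - f(h)|^2 <= eps (r h + 1),
   where adding 1 avoids a division by r h = 0. *)
have hw n : `|w (x_ n) h| ^+ 2 <= (n.+1%:R^-1 * (r h + 1))%:C.
  have r1 : 0 < r h + 1 by rewrite ltr_wpDl.
  pose W := w (x_ n) h; pose c := - ((r h + 1)^-1%:C * Num.conj W).
  have WN : `|W| = (Re `|W|)%:C by rewrite ge0_ReK.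
  set q := Re `|W| in WN.
  have WE : Num.conj W * W = (q ^+ 2)%:C by rewrite mulrC -normCK WN -rmorphXn.
  have wc : Re (w (x_ n) (c *: h)) = - ((r h + 1)^-1 * q ^+ 2).
    by rewrite wZ mulNr -mulrA WE ReN Re_mulC.
  have rc : r (c *: h) = (r h + 1)^-1 ^+ 2 * q ^+ 2 * r h.
    rewrite /r rZ rE normrN normrM norm_conjC exprMn ger0_norm; last first.
      by rewrite ler0c invr_ge0 ltW.
    by rewrite WN -!rmorphXn -!rmorphM.
  have := DJ (x_ n + c *: h); have := hx n.
  rewrite JD wc rc WN -rmorphXn lecR /=.
  move: (n.+1%:R^-1) => k Jk DJk; rewrite -ler_pdivrMr // mulrC.
  have -> : (r h + 1)^-1 * q ^+ 2 =
      2 * ((r h + 1)^-1 * q ^+ 2) - (r h + 1)^-1 ^+ 2 * q ^+ 2 * r h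
      - ((r h + 1)^-1 * q) ^+ 2.
    by field; rewrite gt_eqF.
  have := sqr_ge0 ((r h + 1)^-1 * q); lra.
have wz : (fun n => w (x_ n) h : R[i]^o) @ \oo --> (w (limn x_) h : R[i]^o).
  apply: (cvg_lipschitz (M := `|T h|) _ _ cx) => // n.
  by rewrite /w opprB addrA subrK -innerBr -bopB -Ts inner_bound.
suff w0 : (fun n => w (x_ n) h : R[i]^o) @ \oo --> (0 : R[i]^o).
  exact: (cvg_unique _ wz w0).
apply/cvgrPdist_lt => e e0.
have e0' : 0 < Re e by have := Re_lt e0.
have r1 : 0 < r h + 1 by rewrite ltr_wpDl.
have de0 : 0 < Re e ^+ 2 / (r h + 1) by rewrite divr_gt0 ?exprn_gt0.
have := near_infty_natSinv_lt (PosNum de0); apply: filterS => n /= nlt.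
rewrite sub0r normrN -ltr_sqr ?nnegrE ?(ltW e0) //.
apply: le_lt_trans (hw n) _; rewrite -(ge0_ReK (ltW e0)) -rmorphXn ltcR.
by rewrite -ltr_pdivlMr.
Qed.

End Complete.

(** * Adjoints, the operator order and invertibility *)

Section Operators.
Context {R : realType} {H : hilbertType R}.
Implicit Types (x y z : H) (S T : bop H).
Local Notation Id := (1 : bop H).

Lemma bop_of_bounded (f : H -> H) (M : R[i]) : 0 <= M ->
  linear f -> (forall x, `|f x| <= M * `|x|) ->
  exists T : bop H, forall x, T x = f x.
Proof.
move=> M0 lf fM.
have bf : bounded_linear f.
  apply/asboolP; split=> // x; apply: (cvg_lipschitz (M := M) _ _ cvg_id) => // y.
  have := lf (-1) y x.
  by rewrite !scaleN1r (addrC (- y)) (addrC (- f y)) => <-; exact: fM.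
by exists (Bop bf).
Qed.

(** The vector adjoint T y represents the functional x |-> <Tx,y>, by the Riesz
    theorem, which is the case T = 1 of Lax-Milgram. *)
Lemma adjointP T x y : inner (T x) y = inner x (adjoint T y).
Proof.
move: x y; apply: (@xgetPex _ 0
  [set S : bop H | forall x y : H, inner (T x) y = inner x (S y)]).
have [M M0 TM] := bop_bounded T.
have /choice [S hS] : forall y, exists z, forall x, inner (T x) y = inner x z.
  move=> y; apply: (lax_milgram (T := 1) (d := 1) (M := `|y| * M)) => //.
  - by move=> u v; rewrite bopD innerDl.
  - by move=> c u; rewrite bopZ innerZl.
  - by rewrite mulr_ge0 // ltW.
  - move=> x; rewrite (le_trans (inner_bound _ _)) // mulrC -mulrA.
    by rewrite ler_wpM2l.
  - by move=> x; rewrite mul1r inner_normE.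
have Sbound y : `|S y| <= M * `|y|.
  have [->|Sy0] := eqVneq (S y) 0; first by rewrite normr0 mulr_ge0 // ltW.
  have Sn : 0 < `|S y| by rewrite normr_gt0.
  rewrite -(ler_pM2l Sn) -expr2 -inner_normE -hS.
  rewrite -(ger0_norm (_ : 0 <= inner (T (S y)) y)); last by rewrite hS inner_ge0.
  rewrite (le_trans (inner_bound _ _)) // mulrA ler_wpM2r // mulrC; exact: TM.
have Slin : linear S.
  move=> c u v; apply: eq_inner => x; rewrite (inner_conj (S _)) (inner_conj (_ + _)).
  by rewrite innerDr innerZr -!hS innerDr innerZr.
have [S' S'E] := bop_of_bounded (ltW M0) Slin Sbound.
by exists S' => x y; rewrite S'E.
Qed.

Lemma adjoint_unique S T : (forall x y, inner (T x) y = inner x (S y)) ->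
  adjoint T = S.
Proof.
by move=> TS; apply: bop_eqP => y; apply: eq_inner_r => x; rewrite -adjointP.
Qed.

Lemma adjointM S T : adjoint (S * T) = adjoint T * adjoint S.
Proof. by apply: adjoint_unique => x y; rewrite !bopME !adjointP. Qed.

Lemma adjoint_self T : self_adjoint T -> adjoint T = T.
Proof. exact: adjoint_unique. Qed.

Lemma adjoint1 : adjoint (1 : bop H) = 1.
Proof. exact: adjoint_self. Qed.

Lemma op_ge0_0 : op_ge0 (0 : bop H).
Proof. by move=> x; rewrite bop0E inner0l. Qed.

Lemma op_ge0_1 : op_ge0 (1 : bop H).
Proof. by move=> x; rewrite bop1E inner_ge0. Qed.

Lemma op_ge0D S T : op_ge0 S -> op_ge0 T -> op_ge0 (S + T).
Proof. by move=> S0 T0 x; rewrite bopDE innerDl addr_ge0. Qed.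

Lemma op_ge0Z (c : R[i]) T : 0 <= c -> op_ge0 T -> op_ge0 (c *: T).
Proof. by move=> c0 T0 x; rewrite bopZE innerZl mulr_ge0. Qed.

Lemma op_ge0_conj S T : op_ge0 T -> op_ge0 (S * T * adjoint S).
Proof. by move=> T0 x; rewrite !bopME adjointP T0. Qed.

Lemma op_leP S T : op_le S T <-> forall x, inner (S x) x <= inner (T x) x.
Proof.
by split=> ST x; have := ST x; rewrite bopBE innerBl subr_ge0.
Qed.

Lemma op_le_refl T : op_le T T. Proof. exact/op_leP. Qed.

Lemma op_le_trans S T U : op_le S T -> op_le T U -> op_le S U.
Proof.
move=> /op_leP ST /op_leP TU; apply/op_leP => x; exact: le_trans (ST x) (TU x).
Qed.

Lemma op_leZ (c : R[i]) S T : 0 <= c -> op_le S T -> op_le (c *: S) (c *: T).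
Proof. by move=> c0 ST; rewrite /op_le -scalerBr; exact: op_ge0Z. Qed.

Lemma op_le_scalar T : op_ge0 T -> exists2 c : R[i], 0 < c & op_le T (c *: Id).
Proof.
move=> T0; have [M M0 TM] := bop_bounded T; exists M => //; apply/op_leP => x.
rewrite -(ger0_norm (T0 x)) bopZE bop1E innerZl inner_normE expr2.
by rewrite (le_trans (inner_bound _ _)) // mulrA ler_wpM2r.
Qed.

(** This is T^2 <= c T, which follows from the identity
    c T (c - T) = T (c - T) T + (c - T) T (c - T): its right-hand side is
    positive if 0 <= T <= c. *)
Lemma sqnorm_le_inner T (c : R[i]) x : op_ge0 T -> 0 < c -> op_le T (c *: Id) ->
  `|T x| ^+ 2 <= c * inner (T x) x.
Proof.
move=> T0 c0 Tc; have Ts := op_ge0_self_adjoint T0.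
have cc : Num.conj c = c by rewrite (CrealP (ger0_real (ltW c0))).
rewrite -subr_ge0 -(pmulr_rge0 _ c0).
have := addr_ge0 (Tc (T x)) (T0 (c *: x - T x)).
rewrite bopBE bopZE bop1E bopB bopZ !innerBl !innerBr !innerZl !innerZr cc.
rewrite -inner_normE (Ts (T x) x); congr (_ <= _); ring.
Qed.

(** For D = T - S >= 0 with <Dx,x> = 0 for all x, [sqnorm_le_inner] gives
    D x = 0. *)
Lemma op_le_anti S T : op_le S T -> op_le T S -> S = T.
Proof.
move=> ST TS; have [c c0 Dc] := op_le_scalar ST.
apply: bop_eqP => x; apply/esym/eqP; rewrite -subr_eq0 -normr_eq0 -sqrf_eq0.
rewrite eq_le exprn_ge0 // andbT.
have := sqnorm_le_inner x ST c0 Dc; rewrite bopBE => /le_trans; apply.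
rewrite pmulr_rle0 // innerBl subr_le0; move: x; exact/op_leP.
Qed.

(** The numbers <T_k x,x> decrease to a limit, and [sqnorm_le_inner] for the
    differences T_j - T_k bounds |T_j x - T_k x|^2 by a multiple of the
    differences of these numbers, so each sequence T_k x is Cauchy. *)
Lemma nonincreasing_sot_cvg (T_ : nat -> bop H) :
  (forall k, op_ge0 (T_ k)) -> (forall k, op_le (T_ k.+1) (T_ k)) ->
  exists T, sot_cvg T_ T.
Proof.
move=> T0 TS.
have Tle j k : (j <= k)%N -> op_le (T_ k) (T_ j).
  elim: k => [|k IH]; first by rewrite leqn0 => /eqP ->; exact: op_le_refl.
  rewrite leq_eqVlt ltnS => /predU1P[->|/IH]; first exact: op_le_refl.
  exact: op_le_trans.
have [c c0 Tc] := op_le_scalar (T0 0%N).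
have sq j k x : (j <= k)%N ->
    `|T_ j x - T_ k x| ^+ 2 <= c * (inner (T_ j x) x - inner (T_ k x) x).
  move=> jk; rewrite -innerBl; apply: (sqnorm_le_inner _ (Tle _ _ jk) c0).
  apply: op_le_trans (op_le_trans (Tle 0%N j _) Tc) => //.
  by apply/op_leP => y; rewrite bopBE innerBl gerBl T0.
have cvgx x : cvg ((fun k => T_ k x) @ \oo).
  pose q k := Re (inner (T_ k x) x).
  have qE k : inner (T_ k x) x = (q k)%:C by rewrite ge0_ReK // T0.
  have cq : cvg (q @ \oo).
    apply: nonincreasing_is_cvgn.
      by move=> j k /Tle /op_leP /(_ x); rewrite !qE lecR.
    by exists 0 => _ [k _ <-]; have /Re_le := T0 k x.
  apply: cauchy_sqnorm_cvg => e e0.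
  have c0' : 0 < Re c by have := Re_lt c0.
  have /cvgrPdist_lt/(_ (e / Re c / 2)) := cq.
  rewrite !divr_gt0 // => /(_ isT) [N _ hN].
  have main m n : (N <= m)%N -> (m <= n)%N -> `|T_ m x - T_ n x| ^+ 2 <= e%:C.
    move=> Nm mn; apply: le_trans (sq _ _ x mn) _.
    rewrite !qE -(ge0_ReK (ltW c0)) -rmorphB -rmorphM lecR -ler_pdivlMl // mulrC.
    have := hN _ Nm; have := hN _ (leq_trans Nm mn) => /=.
    rewrite !ltr_norml; move: (e / Re c) (limn _) => ?? /andP[? ?] /andP[? ?]; lra.
  exists N => m n Nm Nn; have [mn|/ltnW nm] := leqP m n; first exact: main.
  by rewrite distrC; exact: main.
pose f x := limn (fun k => T_ k x).
have fE x : (fun k => T_ k x) @ \oo --> f x := cvgx x.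
have flin : linear f.
  move=> a x y; apply: (cvg_unique _ (fE _)) => //=.
  rewrite (_ : (fun k => _) = (fun k => a *: T_ k x + T_ k y)); last first.
    by apply/funext => k; rewrite bopD bopZ.
  by apply: cvgD => //; apply: cvgZ => //; exact: cvg_cst.
have fbound x : `|f x| <= c * `|x|.
  have Tcx k : `|T_ k x| <= c * `|x|.
    rewrite -ler_sqr ?nnegrE ?mulr_ge0 ?(ltW c0) //.
    have Tkc : op_le (T_ k) (c *: Id) by apply: op_le_trans Tc; exact: Tle.
    apply: le_trans (sqnorm_le_inner x (T0 k) c0 Tkc) _.
    rewrite exprMn expr2 -mulrA ler_pM2l //.
    have /op_leP/(_ x) := Tkc; by rewrite bopZE bop1E innerZl inner_normE.
  rewrite -subr_ge0; apply: (@complex_limit_ge0 _ (fun k => c * `|x| - `|T_ k x|)).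
    by move=> k; rewrite subr_ge0.
  apply: cvgB; first exact: cvg_cst.
  exact: cvg_norm.
have [T TE] := bop_of_bounded (ltW c0) flin fbound.
by exists T => x; rewrite TE.
Qed.

(** Surjectivity is Lax-Milgram for the functional x |-> <x,y>, whose solution z
    satisfies T z = y. *)
Lemma bounded_below_invertible T (d : R[i]) : op_ge0 T -> 0 < d ->
  op_le (d *: Id) T -> invertible T.
Proof.
move=> T0 d0 /op_leP dT; have Ts := op_ge0_self_adjoint T0.
have Td x : d * `|x| ^+ 2 <= inner (T x) x.
  by have := dT x; rewrite bopZE bop1E innerZl inner_normE.
have /choice [S TS] : forall y, exists z, T z = y.
  move=> y; have [z zE] : exists z, forall x, inner x y = inner x (T z).
    apply: (lax_milgram (M := `|y|) (d := d)) => // [u v|c u|x].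
    - by rewrite innerDl.
    - by rewrite innerZl.
    - by rewrite mulrC inner_bound.
  by exists z; apply: eq_inner_r => x; rewrite zE.
have Tinj x y : T x = T y -> x = y.
  move=> Txy; apply/eqP; rewrite -subr_eq0 -normr_eq0 -sqrf_eq0 eq_le exprn_ge0 // andbT.
  by rewrite -(pmulr_rle0 _ d0) (le_trans (Td _)) // bopB Txy subrr inner0l.
have Slin : linear S by move=> a x y; apply: Tinj; rewrite TS bopD bopZ !TS.
have Sbound y : `|S y| <= d^-1 * `|y|.
  rewrite mulrC ler_pdivlMr // mulrC.
  have [->|Sy0] := eqVneq (S y) 0; first by rewrite normr0 mulr0.
  have Sn : 0 < `|S y| by rewrite normr_gt0.
  rewrite -(ler_pM2r Sn) -mulrA -expr2 (le_trans (Td _)) //.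
  by rewrite -(ger0_norm (T0 _)) (le_trans (inner_bound _ _)) // TS.
have [|S' SE] := bop_of_bounded _ Slin Sbound; first by rewrite invr_ge0 ltW.
exists S'; split; apply: bop_eqP => x; last by rewrite bopME SE TS.
by apply: Tinj; rewrite bopME SE TS.
Qed.

(** If 0 <= T <= c and S inverts T, then |x| <= |S| |T x|, while
    |T x|^2 <= c <Tx,x> by [sqnorm_le_inner]. *)
Lemma invertible_bounded_below T : op_ge0 T -> invertible T ->
  exists2 d : R[i], 0 < d & op_le (d *: Id) T.
Proof.
move=> T0 [S [ST _]]; have [c c0 Tc] := op_le_scalar T0.
have [M M0 SM] := bop_bounded S.
exists (M ^- 2 / c); first by rewrite divr_gt0 ?invr_gt0 ?exprn_gt0.
apply/op_leP => x; rewrite bopZE bop1E innerZl inner_normE.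
rewrite mulrAC ler_pdivrMr // mulrC ler_pdivrMr ?exprn_gt0 //.
have xE : S (T x) = x by rewrite -bopME ST.
apply: (@le_trans _ _ (M ^+ 2 * `|T x| ^+ 2)).
  by rewrite -exprMn lerXn2r ?nnegrE ?mulr_ge0 ?(ltW M0) // -{1}xE SM.
rewrite mulrC ler_wpM2r ?exprn_ge0 ?(ltW M0) // mulrC.
exact: sqnorm_le_inner.
Qed.

End Operators.

(** * Square roots of positive operators *)

Section SquareRoot.
Context {R : realType} {H : hilbertType R}.
Implicit Types (x y z : H) (S T B : bop H).
Local Notation Id := (1 : bop H).

(** The polynomials in B with nonnegative coefficients. They commute, and they are
    positive as soon as B is; the iterates of the square root algorithm and
    their increments are of this kind, which is why that algorithm is
    monotone. *)
Inductive nonneg_poly B : bop H -> Prop :=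
| nonneg_poly0 : nonneg_poly B 0
| nonneg_polyD S T : nonneg_poly B S -> nonneg_poly B T -> nonneg_poly B (S + T)
| nonneg_polyZX (c : R[i]) k : 0 <= c -> nonneg_poly B (c *: B ^+ k).

Lemma nonneg_polyM B S T :
  nonneg_poly B S -> nonneg_poly B T -> nonneg_poly B (S * T).
Proof.
elim=> [|S1 S2 _ IH1 _ IH2 T0|c k c0].
- by rewrite mul0r; constructor.
- by rewrite mulrDl; constructor; [exact: IH1|exact: IH2].
elim=> [|T1 T2 _ IH1 _ IH2|d l d0].
- by rewrite mulr0; constructor.
- by rewrite mulrDr; constructor.
by rewrite bopZAl bopZAr scalerA -exprD; constructor; rewrite mulr_ge0.
Qed.

Lemma nonneg_polyZ B (c : R[i]) S :
  0 <= c -> nonneg_poly B S -> nonneg_poly B (c *: S).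
Proof.
move=> c0; elim=> [|S1 S2 _ IH1 _ IH2|d k d0].
- by rewrite scaler0; constructor.
- by rewrite scalerDr; constructor.
- by rewrite scalerA; constructor; rewrite mulr_ge0.
Qed.

Lemma nonneg_polyC B S T : nonneg_poly B S -> nonneg_poly B T -> S * T = T * S.
Proof.
elim=> [|S1 S2 _ IH1 _ IH2 T0|c k c0].
- by rewrite mul0r mulr0.
- by rewrite mulrDl mulrDr IH1 // IH2.
elim=> [|T1 T2 _ IH1 _ IH2|d l d0].
- by rewrite mul0r mulr0.
- by rewrite mulrDl mulrDr IH1 IH2.
by rewrite !bopZAl !bopZAr !scalerA mulrC -!exprD addnC.
Qed.

(** By induction in steps of two: <B^(k+2) x,x> = <B^k (Bx),Bx>. *)
Lemma op_ge0X B k : op_ge0 B -> op_ge0 (B ^+ k).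
Proof.
move=> B0; have Bs := op_ge0_self_adjoint B0.
elim/ltn_ind: k => -[|[|k]] IH; first by rewrite expr0; exact: op_ge0_1.
  by rewrite expr1.
by move=> x; rewrite exprS exprSr !bopME Bs; exact: IH.
Qed.

Lemma nonneg_poly_ge0 B S : op_ge0 B -> nonneg_poly B S -> op_ge0 S.
Proof.
move=> B0; elim=> [|S1 S2 _ IH1 _ IH2|c k c0]; first exact: op_ge0_0.
  exact: op_ge0D.
by apply: op_ge0Z => //; exact: op_ge0X.
Qed.

Lemma contraction_norm S x : op_ge0 S -> op_le S Id -> `|S x| <= `|x|.
Proof.
move=> S0 S1; rewrite -ler_sqr ?nnegrE //.
have := sqnorm_le_inner x S0 ltr01; rewrite scale1r mul1r => /(_ S1)/le_trans.
by apply; have /op_leP/(_ x) := S1; rewrite bop1E inner_normE.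
Qed.

(** With B = 1 - T, the iteration X_0 = 0, X_(k+1) = (B + X_k^2) / 2 increases to
    a solution X of X = (B + X^2) / 2, that is, of (1 - X)^2 = T. The
    increments are positive because
    X_(k+2) - X_(k+1) = (X_(k+1) - X_k) (X_(k+1) + X_k) / 2
    is a polynomial in B with nonnegative coefficients. *)
Lemma contraction_sqrt T : op_ge0 T -> op_le T Id ->
  exists2 S, op_ge0 S & S * S = T.
Proof.
move=> T0 T1; pose B := Id - T.
have B0 : op_ge0 B by [].
have B1 : op_le B Id by rewrite /op_le opprB addrC subrK.
pose h : R[i] := 2^-1; have h0 : 0 <= h by rewrite invr_ge0.
have hh : h + h = 1 by rewrite -mulr2n -(mulr_natr h) mulVf // pnatr_eq0.
pose X := fix X k := if k is k'.+1 then h *: (B + X k' * X k') else 0.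
have npB : nonneg_poly B B.
  by rewrite -[X in nonneg_poly _ X]expr1 -[X in nonneg_poly _ X]scale1r; constructor.
have npX k : nonneg_poly B (X k).
  elim: k => [|k IH] /=; first by constructor.
  by apply: nonneg_polyZ => //; constructor => //; exact: nonneg_polyM.
have npXS k : nonneg_poly B (X k.+1 - X k).
  elim: k => [|k IH].
    rewrite /= mulr0 addr0 subr0; exact: nonneg_polyZ.
  rewrite (_ : _ - _ = h *: ((X k.+1 - X k) * (X k.+1 + X k))).
    apply: nonneg_polyZ => //; apply: nonneg_polyM => //.
    by apply: nonneg_polyD.
  rewrite [X k.+2]/= [in RHS]mulrDr !mulrBl (nonneg_polyC (npX k) (npX k.+1)).
  rewrite addrA subrK [in X in _ - X]/= -scalerBr; congr (_ *: _).
  by rewrite opprD addrACA subrr add0r.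
have Xnorm k x : `|X k x| <= `|x|.
  elim: k x => [|k IH] x; first by rewrite (_ : X 0 x = 0) ?normr0.
  rewrite [X k.+1]/= bopZE bopDE bopME normrZ ger0_norm // -[leRHS]mul1r -hh mulrDl.
  rewrite -mulrDr ler_wpM2l // (le_trans (ler_normD _ _)) // lerD //.
    exact: contraction_norm.
  by rewrite (le_trans (IH _)).
pose U k := Id - X k.
have U0 k : op_ge0 (U k).
  apply/op_leP => x; rewrite bop1E inner_normE expr2.
  rewrite -(ger0_norm (nonneg_poly_ge0 B0 (npX k) x)).
  by rewrite (le_trans (inner_bound _ _)) // ler_wpM2r.
have U1 k : op_le (U k) Id.
  by rewrite /op_le opprB addrC subrK; exact: nonneg_poly_ge0 (npX k).
have [|S US] := nonincreasing_sot_cvg U0.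
  move=> k; rewrite /op_le opprB addrC addrA subrK.
  exact: nonneg_poly_ge0 (npXS k).
exists S; first exact: wot_op_ge0 U0 (sot_wot US).
(* the iteration in terms of U = 1 - X, whose limit is the square root *)
have UE k : U k.+1 = U k + h *: (T - U k * U k).
  rewrite /U /= mulrBl mul1r mulrBr mulr1.
  have -> : T - (Id - X k - (X k - X k * X k)) = (X k + X k) - (B + X k * X k).
    have zmodE (V : zmodType) (i b x q : V) :
        (i - b) - (i - x - (x - q)) = (x + x) - (b + q).
      rewrite !opprB opprD (addrACA x) (addrCA (i - b)); congr (_ + _).
      by rewrite [i - b]addrC [- q - i]addrC addrA addrK.
    rewrite -(zmodE _ Id); congr (_ - _).
    by rewrite /B opprB addrC subrK.
  rewrite scalerBr (_ : h *: (X k + X k) = X k); first by rewrite addrA subrK.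
  by rewrite scalerDr -scalerDl hh scale1r.
have UUS x : (fun k => U k (U k x)) @ \oo --> S (S x).
  rewrite -[S (S x)]add0r.
  rewrite (_ : (fun k => _) = (fun k => U k (U k x - S x) + U k (S x))); last first.
    by apply/funext => k; rewrite bopB subrK.
  apply: cvgD; last exact: US.
  apply: (cvg_lipschitz (M := 1) _ _ (US x)) => // k.
  by rewrite sub0r normrN mul1r [leRHS]distrC; exact: contraction_norm.
apply: bop_eqP => x; rewrite bopME.
have c2 : (fun k => U k.+1 x) @ \oo --> S x + h *: (T x - S (S x)).
  rewrite (_ : (fun k => _) = (fun k => U k x + h *: (T x - U k (U k x)))); last first.
    by apply/funext => k; rewrite UE.
  apply: cvgD => //; apply: cvgZ; first exact: cvg_cst.
  by apply: cvgB => //; exact: cvg_cst.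
have c1 : (fun k => U k.+1 x) @ \oo --> S x by rewrite (cvg_shiftS (fun k => U k x)).
have E : S x = S x + h *: (T x - S (S x)) := cvg_unique _ c1 c2.
have {}E : h *: (T x - S (S x)) = 0 by apply: (@addrI _ (S x)); rewrite addr0 -E.
have h1 : h != 0 by rewrite invr_eq0 pnatr_eq0.
by apply/esym/eqP; rewrite -subr_eq0 -(can_eq (scalerK h1)) E scaler0.
Qed.

Lemma op_sqrt T : op_ge0 T -> exists2 S, op_ge0 S & S * S = T.
Proof.
move=> T0; have [c c0 Tc] := op_le_scalar T0.
have ci0 : 0 <= c^-1 by rewrite invr_ge0 ltW.
have [||S S0 SS] := @contraction_sqrt (c^-1 *: T).
- exact: op_ge0Z.
- by have := op_leZ ci0 Tc; rewrite scalerA mulVf ?gt_eqF // scale1r.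
exists (sqrtC c *: S); first by apply: op_ge0Z; rewrite ?sqrtC_ge0 ?(ltW c0).
by rewrite bopZAl bopZAr SS !scalerA -expr2 sqrtCK mulfV ?gt_eqF // scale1r.
Qed.

End SquareRoot.

(** * Calculus of weak limits *)

Section WeakLimits.
Context {R : realType} {H : hilbertType R}.
Implicit Types (x y z : H) (S T B : bop H).
Local Notation Id := (1 : bop H).

Lemma wot_cst T : wot_cvg (fun=> T) T.
Proof. by move=> x y; exact: cvg_cst. Qed.

Lemma wotD (S_ T_ : nat -> bop H) S T : wot_cvg S_ S -> wot_cvg T_ T ->
  wot_cvg (fun k => S_ k + T_ k) (S + T).
Proof.
move=> SS TT x y; rewrite bopDE innerDl.
under eq_fun do rewrite bopDE innerDl.
exact: (cvgD (SS x y) (TT x y)).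
Qed.

Lemma wotZ (c : R[i]) (T_ : nat -> bop H) T : wot_cvg T_ T ->
  wot_cvg (fun k => c *: T_ k) (c *: T).
Proof.
move=> TT x y; rewrite bopZE innerZl.
under eq_fun do rewrite bopZE innerZl.
exact: (cvgMl_tmp (TT x y)).
Qed.

Lemma wotB (S_ T_ : nat -> bop H) S T : wot_cvg S_ S -> wot_cvg T_ T ->
  wot_cvg (fun k => S_ k - T_ k) (S - T).
Proof.
move=> SS TT x y; rewrite bopBE innerBl.
under eq_fun do rewrite bopBE innerBl.
exact: (cvgB (SS x y) (TT x y)).
Qed.

Lemma wot_mul U V (T_ : nat -> bop H) T : wot_cvg T_ T ->
  wot_cvg (fun k => U * T_ k * V) (U * T * V).
Proof.
move=> TT x y; rewrite !bopME adjointP.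
under eq_fun do rewrite !bopME adjointP.
exact: TT.
Qed.

Lemma wot_sum (I : Type) (r : seq I) (F : I -> nat -> bop H) (G : I -> bop H) :
  (forall i, wot_cvg (F i) (G i)) ->
  wot_cvg (fun k => \sum_(i <- r) F i k) (\sum_(i <- r) G i).
Proof.
move=> FG; elim: r => [|i r IH].
  rewrite big_nil; under eq_fun do rewrite big_nil.
  exact: wot_cst.
rewrite big_cons; under eq_fun do rewrite big_cons.
exact: (wotD (FG i) IH).
Qed.

Lemma wot_shift j (T_ : nat -> bop H) T :
  wot_cvg (fun k => T_ (k + j)%N) T <-> wot_cvg T_ T.
Proof.
split=> TT x y; have := TT x y;
  by rewrite (cvg_shiftn j (fun k => inner (T_ k x) y : R[i]^o)).
Qed.

Lemma wot_op_le (S_ T_ : nat -> bop H) S T : (forall k, op_le (S_ k) (T_ k)) ->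
  wot_cvg S_ S -> wot_cvg T_ T -> op_le S T.
Proof. by move=> ST SS TT; apply: wot_op_ge0 ST (wotB TT SS). Qed.

Lemma nondecreasing_le_wot (T_ : nat -> bop H) T :
  (forall k, op_le (T_ k) (T_ k.+1)) -> wot_cvg T_ T -> forall k, op_le (T_ k) T.
Proof.
move=> TS TT k; apply: (wot_op_le _ (@wot_cst (T_ k)) ((@wot_shift k T_ T).2 TT)) => j.
elim: j => [|j IH]; first exact: op_le_refl.
by apply: op_le_trans IH _; rewrite addSn.
Qed.

Lemma nondecreasing_sot_cvg (T_ : nat -> bop H) C :
  (forall k, op_le (T_ k) C) -> (forall k, op_le (T_ k) (T_ k.+1)) ->
  exists T, sot_cvg T_ T.
Proof.
move=> TC TS; have [|S SS] := nonincreasing_sot_cvg TC.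
  by move=> k; rewrite /op_le opprB addrC addrA subrK; exact: TS.
exists (C - S) => x; rewrite (_ : (fun k => _) = (fun k => C x - (C - T_ k) x)).
  by apply: cvgB; [exact: cvg_cst|exact: SS].
by apply/funext => k; rewrite bopBE subKr.
Qed.

End WeakLimits.

(** * The completely positive map of a free holomorphic function *)

Section PhiTheory.
Context {R : realType} {H : hilbertType R} {n : nat}.
Variables (a : seq 'I_n -> R).
Hypothesis a_ge0 : forall w, 0 <= a w.
Implicit Types (X A T : 'I_n -> bop H) (U V W Y Z : bop H).
Local Notation Id := (1 : bop H).

Lemma Phi_partialD X V W N :
  Phi_partial a X (V + W) N = Phi_partial a X V N + Phi_partial a X W N.
Proof.
rewrite /Phi_partial -big_split; apply: eq_bigr => k _ /=.
rewrite -big_split; apply: eq_bigr => w _ /=.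
by rewrite mulrDr mulrDl scalerDr.
Qed.

Lemma Phi_partialZ X (c : R[i]) W N :
  Phi_partial a X (c *: W) N = c *: Phi_partial a X W N.
Proof.
rewrite /Phi_partial scaler_sumr; apply: eq_bigr => k _ /=.
rewrite scaler_sumr; apply: eq_bigr => w _ /=.
by rewrite bopZAr bopZAl !scalerA mulrC.
Qed.

Lemma Phi_partialB X V W N :
  Phi_partial a X (V - W) N = Phi_partial a X V N - Phi_partial a X W N.
Proof. by rewrite -scaleN1r Phi_partialD Phi_partialZ scaleN1r. Qed.

Lemma Phi_partial_wot X (W_ : nat -> bop H) W N : wot_cvg W_ W ->
  wot_cvg (fun k => Phi_partial a X (W_ k) N) (Phi_partial a X W N).
Proof.
by move=> WW; apply: wot_sum => k; apply: wot_sum => w; apply/wotZ/wot_mul.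
Qed.

Lemma op_ge0_sum (I : Type) (r : seq I) (F : I -> bop H) :
  (forall i, op_ge0 (F i)) -> op_ge0 (\sum_(i <- r) F i).
Proof.
move=> F0; elim: r => [|i r IH]; first by rewrite big_nil; exact: op_ge0_0.
by rewrite big_cons; exact: op_ge0D.
Qed.

Lemma Phi_layer_ge0 X W k : op_ge0 W -> op_ge0
  (\sum_(w : k.-tuple 'I_n) (a w)%:C *: (opword X w * W * adjoint (opword X w))).
Proof.
move=> W0; apply: op_ge0_sum => w.
by apply: op_ge0Z; [rewrite ler0c|exact: op_ge0_conj].
Qed.

Lemma Phi_partial_ge0 X W N : op_ge0 W -> op_ge0 (Phi_partial a X W N).
Proof. by move=> W0; apply: op_ge0_sum => k; exact: Phi_layer_ge0. Qed.

Lemma Phi_partial_nondecreasing X W N : op_ge0 W ->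
  op_le (Phi_partial a X W N) (Phi_partial a X W N.+1).
Proof.
move=> W0; rewrite /op_le /Phi_partial [X in X - _]big_nat_recr //=.
by rewrite addrAC subrr add0r; exact: Phi_layer_ge0.
Qed.

Lemma Phi_eq X W V : wot_cvg (Phi_partial a X W) V -> Phi a X W = V.
Proof.
move=> WV; refine (wot_unique _ WV).
exact: (@xgetPex _ 0 [set Z | wot_cvg (Phi_partial a X W) Z] (ex_intro _ V WV)).
Qed.

(** If 0 <= W <= c, the partial sums at W increase and are at most c times those
    at 1, hence at most c Z, where Z is the weak limit at 1. *)
Lemma Phi_cvg X W : Phi_defined a X -> op_ge0 W ->
  wot_cvg (Phi_partial a X W) (Phi a X W).
Proof.
move=> [Z XZ] W0; have [c c0 Wc] := op_le_scalar W0.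
have PZ N : op_le (Phi_partial a X W N) (c *: Z).
  apply: (@op_le_trans _ _ _ (c *: Phi_partial a X 1 N)).
    rewrite -Phi_partialZ /op_le -Phi_partialB; exact: Phi_partial_ge0.
  apply: op_leZ (ltW c0) _; move: N; apply: (nondecreasing_le_wot _ XZ) => N.
  exact: Phi_partial_nondecreasing op_ge0_1.
have [V PV] := nondecreasing_sot_cvg PZ (fun N => @Phi_partial_nondecreasing X W N W0).
by rewrite (Phi_eq (sot_wot PV)); exact: sot_wot.
Qed.

Lemma Phi0 X : Phi a X 0 = 0.
Proof.
apply: Phi_eq; rewrite (_ : Phi_partial a X 0 = fun=> 0); first exact: wot_cst.
by apply/funext => N; rewrite -[0 in LHS](scale0r Id) Phi_partialZ scale0r.
Qed.

Lemma Phi_ge0 X W : Phi_defined a X -> op_ge0 W -> op_ge0 (Phi a X W).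
Proof.
move=> Xd W0; apply: (wot_op_ge0 _ (Phi_cvg Xd W0)) => N; exact: Phi_partial_ge0.
Qed.

Lemma Phi_partial_le X W N : Phi_defined a X -> op_ge0 W ->
  op_le (Phi_partial a X W N) (Phi a X W).
Proof.
move=> Xd W0; apply: (nondecreasing_le_wot _ (Phi_cvg Xd W0) N) => k.
exact: Phi_partial_nondecreasing.
Qed.

Lemma PhiZ X (c : R[i]) W : Phi_defined a X -> op_ge0 W ->
  Phi a X (c *: W) = c *: Phi a X W.
Proof.
move=> Xd W0; apply: Phi_eq.
rewrite (funext (Phi_partialZ X c W)); exact/wotZ/Phi_cvg.
Qed.

Lemma PhiB X V W : Phi_defined a X -> op_ge0 V -> op_ge0 W ->
  Phi a X (V - W) = Phi a X V - Phi a X W.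
Proof.
move=> Xd V0 W0; apply: Phi_eq.
rewrite (funext (Phi_partialB X V W)); apply: wotB; exact: Phi_cvg.
Qed.

Lemma Phi_mono X V W : Phi_defined a X -> op_ge0 V -> op_le V W ->
  op_le (Phi a X V) (Phi a X W).
Proof.
move=> Xd V0 VW; rewrite /op_le -PhiB //; first exact: Phi_ge0.
by rewrite -(subrK V W); exact: op_ge0D.
Qed.

(** Fatou's lemma: a partial sum at W is the limit of the partial sums at the
    W_k, each of which is at most Phi(W_k). *)
Lemma Phi_fatou X (W_ : nat -> bop H) W V : Phi_defined a X ->
  (forall k, op_ge0 (W_ k)) -> wot_cvg W_ W ->
  wot_cvg (fun k => Phi a X (W_ k)) V -> op_le (Phi a X W) V.
Proof.
move=> Xd W0 WW WV; have W0' := wot_op_ge0 W0 WW.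
apply: (wot_op_le _ (Phi_cvg Xd W0') (@wot_cst _ _ V)) => N.
apply: (wot_op_le _ (@Phi_partial_wot X W_ W N WW) WV) => k.
exact: Phi_partial_le.
Qed.

(** In a product of factors U T_i V all the inner V U cancel; the empty word is
    the reason why U V = 1 is required as well. *)
Lemma opword_conj A T U V w : is_inverse U V -> (forall i, A i = U * T i * V) ->
  opword A w = U * opword T w * V.
Proof.
move=> [UV VU] AT; rewrite /opword; elim: w => [|i w IH].
  by rewrite !big_nil mulr1 UV.
by rewrite !big_cons IH AT !mulrA -(mulrA (U * T i)) VU mulr1.
Qed.

Lemma Phi_partial_conj A T U V W N : is_inverse U V ->
  (forall i, A i = U * T i * V) ->
  Phi_partial a A W N = U * Phi_partial a T (V * W * adjoint V) N * adjoint U.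
Proof.
move=> UV AT; rewrite /Phi_partial mulr_sumr mulr_suml; apply: eq_bigr => k _.
rewrite mulr_sumr mulr_suml; apply: eq_bigr => w _.
by rewrite bopZAr bopZAl (opword_conj _ UV AT) !adjointM !mulrA.
Qed.

Lemma Phi_defined_conj A T U V : is_inverse U V ->
  (forall i, A i = U * T i * V) -> Phi_defined a T -> Phi_defined a A.
Proof.
move=> UV AT Td; exists (U * Phi a T (V * 1 * adjoint V) * adjoint U).
rewrite (funext (fun N => Phi_partial_conj 1 N UV AT)).
apply: wot_mul; apply: Phi_cvg => //; apply: op_ge0_conj; exact: op_ge0_1.
Qed.

Lemma Phi_conj A T U V W : is_inverse U V ->
  (forall i, A i = U * T i * V) -> Phi_defined a T -> op_ge0 W ->
  Phi a A W = U * Phi a T (V * W * adjoint V) * adjoint U.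
Proof.
move=> UV AT Td W0; apply: Phi_eq.
rewrite (funext (fun N => Phi_partial_conj W N UV AT)).
by apply: wot_mul; apply: Phi_cvg => //; exact: op_ge0_conj.
Qed.

Lemma nc_eval_conj A T U V (p : nc_poly R n) : is_inverse U V ->
  (forall i, A i = U * T i * V) -> nc_eval p A = U * nc_eval p T * V.
Proof.
move=> UV AT; rewrite /nc_eval mulr_sumr mulr_suml; apply: eq_bigr => w _.
by rewrite bopZAr bopZAl (opword_conj _ UV AT).
Qed.

End PhiTheory.

(** * Fixed points and similarity *)

Section Corollary.
Context {R : realType} {H : hilbertType R} {n : nat}.
Variables (a : seq 'I_n -> R).
Hypothesis a_ge0 : forall w, 0 <= a w.
Implicit Types (X A T : 'I_n -> bop H) (D G Q U V W Y Z : bop H).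
Local Notation Id := (1 : bop H).

Lemma iter_Phi_ge0 X k : Phi_defined a X -> op_ge0 (iter k (Phi a X) 1).
Proof.
by move=> Xd; elim: k => [|k IH]; [exact: op_ge0_1|exact: Phi_ge0].
Qed.

Lemma Phi_contractive_sot_cvg X : Phi_defined a X -> op_le (Phi a X 1) 1 ->
  exists Q, sot_cvg (fun k => iter k (Phi a X) 1) Q.
Proof.
move=> Xd X1; apply: nonincreasing_sot_cvg => k; first exact: iter_Phi_ge0.
elim: k => [//|k IH]; apply: (Phi_mono a_ge0 Xd _ IH); exact: (@iter_Phi_ge0 X k.+1).
Qed.

(** Fatou's lemma for the iterates W_k gives Phi(Q) <= Q. As Q is bounded below,
    1 <= c Q; applying Phi repeatedly, W_k <= c Q, and Fatou's lemma for the
    positive operators c Q - W_k gives c Phi(Q) - Phi(Q) <= c Phi(Q) - Q. *)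
Lemma Phi_limit_fixed X Q : Phi_defined a X ->
  sot_cvg (fun k => iter k (Phi a X) 1) Q -> invertible Q -> Phi a X Q = Q.
Proof.
move=> Xd /sot_wot QQ Qinv; set W := fun k => _ in QQ.
have W0 k : op_ge0 (W k) by exact: iter_Phi_ge0.
have Q0 : op_ge0 Q := wot_op_ge0 W0 QQ.
have WS : wot_cvg (fun k => Phi a X (W k)) Q.
  by have := (@wot_shift _ _ 1 W Q).2 QQ; under eq_fun do rewrite addn1.
have leQ : op_le (Phi a X Q) Q by exact: (Phi_fatou a_ge0 Xd W0 QQ WS).
apply: (op_le_anti leQ).
have [d d0 dQ] := invertible_bounded_below Q0 Qinv.
pose c := d^-1; have c0 : 0 <= c by rewrite invr_ge0 ltW.
have WcQ k : op_le (W k) (c *: Q).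
  elim: k => [|k IH].
    by have := op_leZ c0 dQ; rewrite scalerA mulVf ?gt_eqF // scale1r.
  apply: (@op_le_trans _ _ _ (Phi a X (c *: Q))); first exact: Phi_mono.
  by rewrite PhiZ //; exact: op_leZ c0 leQ.
have cQ0 := op_ge0Z c0 Q0.
have cW : wot_cvg (fun k => Phi a X (c *: Q - W k)) (c *: Phi a X Q - Q).
  rewrite (_ : (fun k => _) = (fun k => c *: Phi a X Q - Phi a X (W k))).
    exact: (wotB (@wot_cst _ _ _) WS).
  by apply/funext => k; rewrite PhiB // PhiZ.
have := Phi_fatou a_ge0 Xd WcQ (wotB (@wot_cst _ _ (c *: Q)) QQ) cW.
rewrite PhiB // PhiZ // => /op_leP le; apply/op_leP => x.
by have := le x; rewrite !bopBE !innerBl lerD2l lerN2.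
Qed.

(** With E = D - Phi(D), a fixed point, Phi^N(D) = D - N E. So N E <= D for all N,
    which forces the positive operator E to vanish. *)
Lemma defect_fixed_eq0 X D : Phi_defined a X -> op_ge0 D ->
  op_ge0 (D - Phi a X D) -> Phi a X (D - Phi a X D) = D - Phi a X D ->
  D - Phi a X D = 0.
Proof.
move=> Xd D0; set E := D - Phi a X D => E0 EE.
have NE N : op_ge0 (D - (N%:R : R[i]) *: E).
  elim: N => [|N IH]; first by rewrite scale0r subr0.
  have NE0 : op_ge0 ((N%:R : R[i]) *: E) by apply: op_ge0Z.
  have := Phi_ge0 a_ge0 Xd IH; rewrite PhiB // PhiZ // EE.
  have -> : Phi a X D = D - E by rewrite subKr.
  by rewrite -natr1 scalerDl scale1r (opprD (_ *: E)) addrA (addrAC D (- E)).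
apply: op_le_anti; last by rewrite /op_le subr0.
apply/op_leP => x; rewrite bop0E inner0l.
have e0 := ge0_ReK (E0 x); have d0 := ge0_ReK (D0 x).
rewrite -e0 lecR leNgt; apply/negP => e1.
set e := complex.Re _ in e0 e1; set d := complex.Re _ in d0.
have dd : 0 <= d by have := D0 x; rewrite -d0 ler0c.
have := archi_boundP (divr_ge0 dd (ltW e1)); set N := Num.bound _ => dN.
have := NE N x; rewrite bopBE bopZE innerBl innerZl subr_ge0 -e0 -d0.
rewrite -(rmorph_nat (real_complex R)) -rmorphM lecR leNgt => /negP; apply.
by rewrite -ltr_pdivrMr.
Qed.

(** By [defect_fixed_eq0] a vanishing defect of order s + 2 makes the one of order
    s + 1 vanish, down to the first defect 1 - Phi(1). *)
Lemma defect_eq0_fixed X m : Phi_defined a X ->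
  (forall s, (s <= m)%N -> op_ge0 (defect a X s)) ->
  defect a X m.+1 = 0 -> Phi a X 1 = 1.
Proof.
move=> Xd; elim: m => [|m IH] D0 Dm.
  by apply/esym/eqP; rewrite -subr_eq0; apply/eqP.
apply: IH => [s sm|]; first by apply: D0; exact: leqW.
apply: defect_fixed_eq0 => //; [exact: D0|exact: (D0 m.+1)|].
by apply/esym/eqP; rewrite -subr_eq0; apply/eqP.
Qed.

(** The operator G = Y^-1 (Y^-1)^* corresponds to 1 under the similarity, so it is
    fixed by Phi_A; from G <= c one gets G = Phi_A^k(G) <= c Phi_A^k(1). *)
Lemma similar_fixed_invertible A Q T Y Yinv : Phi_defined a A ->
  Phi_defined a T ->
  sot_cvg (fun k => iter k (Phi a A) 1) Q ->
  is_inverse Yinv Y -> (forall i, A i = Yinv * T i * Y) -> Phi a T 1 = 1 ->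
  invertible Q.
Proof.
move=> Ad Td /sot_wot AQ YY AT T1; pose G := Yinv * adjoint Yinv.
have [YiY YYi] := YY.
have G0 : op_ge0 G.
  by rewrite /G -[Yinv in X in op_ge0 X]mulr1; apply: op_ge0_conj; exact: op_ge0_1.
have AG : Phi a A G = G.
  rewrite (Phi_conj a_ge0 YY AT Td G0) /G !mulrA YYi mul1r.
  by rewrite -adjointM YYi adjoint1 T1 mulr1.
have [c c0 Gc] := op_le_scalar G0.
have Gk k : op_le G (c *: iter k (Phi a A) 1).
  elim: k => [//|k IH]; rewrite -AG iterS -PhiZ //; last exact: iter_Phi_ge0.
  exact: Phi_mono.
have GQ : op_le G (c *: Q) := wot_op_le Gk (@wot_cst _ _ G) (wotZ AQ).
have Q0 : op_ge0 Q by apply: (wot_op_ge0 _ AQ) => k; exact: iter_Phi_ge0.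
have [d d0 dG] : exists2 d : R[i], 0 < d & op_le (d *: Id) G.
  apply: invertible_bounded_below G0 _.
  exists (adjoint Y * Y); split.
    by rewrite /G mulrA -(mulrA (adjoint Y)) YYi mulr1 -adjointM YiY adjoint1.
  by rewrite /G mulrA -(mulrA Yinv) -adjointM YYi adjoint1 mulr1.
apply: (@bounded_below_invertible _ _ _ (c^-1 * d)) => //.
  by rewrite mulr_gt0 ?invr_gt0.
have ci0 : 0 <= c^-1 by rewrite invr_ge0 ltW.
have := op_leZ ci0 (op_le_trans dG GQ).
by rewrite !scalerA mulVf ?gt_eqF // scale1r.
Qed.

(** Conjugation by the square root S of Q: with T_i = S^-1 A_i S one has
    Phi_T(1) = S^-1 Phi_A(S S) S^-1 = S^-1 Q S^-1 = 1. *)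
Lemma fixed_similar A Q : Phi_defined a A -> op_ge0 Q -> invertible Q ->
  Phi a A Q = Q ->
  exists (T : 'I_n -> bop H) Y Yinv, [/\ Phi_defined a T, Phi a T 1 = 1,
    is_inverse Y Yinv, forall i, T i = Y * A i * Yinv &
    forall i, A i = Yinv * T i * Y].
Proof.
move=> Ad Q0 [Qi [QiQ QQi]] AQ; have [S S0 SS] := op_sqrt Q0.
have Ss := adjoint_self (op_ge0_self_adjoint S0).
have [Si SiS SSi] : exists2 Si, Si * S = 1 & S * Si = 1.
  have SiS : Qi * S * S = 1 by rewrite -mulrA SS.
  exists (Qi * S) => //; have E : S * (S * Qi) = 1 by rewrite mulrA SS.
  by rewrite -[Qi * S]mulr1 -E (mulrA (Qi * S)) SiS mul1r.
pose T i := Si * A i * S.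
have AT i : A i = S * T i * Si.
  by rewrite /T !mulrA SSi mul1r -mulrA SSi mulr1.
have inv : is_inverse Si S by [].
have TA i : T i = Si * A i * S by [].
exists T, Si, S; split=> //; first exact: (Phi_defined_conj a_ge0 inv TA Ad).
rewrite (Phi_conj a_ge0 inv TA Ad op_ge0_1) mulr1 Ss SS AQ -SS mulrA SiS mul1r.
by rewrite -[X in X * _]Ss -adjointM SiS adjoint1.
Qed.

End Corollary.

Theorem corollary3p6 (R : realType) (H : hilbertType R) (n m : nat)
    (n_gt0 : (0 < n)%N) (m_gt0 : (0 < m)%N)
    (a : seq 'I_n -> R) (af : positive_regular_free_holomorphic a)
    (P : set (nc_poly R n)) (A : 'I_n -> bop H)
    (A_cvg : Phi_defined a A)
    (A_P : forall p, P p -> nc_eval p A = 0) :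
  (forall Q : bop H,
     sot_cvg (fun k => iter k (Phi a A) 1) Q ->
     (invertible Q <->
      exists (T : 'I_n -> bop H) (Y Yinv : bop H),
        [/\ noncomm_variety a P m T,
            defect a T m = 0,
            is_inverse Yinv Y &
            forall i, A i = Yinv * T i * Y])) /\
  (op_le (Phi a A 1) 1 ->
   exists Q : bop H, sot_cvg (fun k => iter k (Phi a A) 1) Q).
Proof.
have [_ a_ge0 _ _] := af.
split; last exact: Phi_contractive_sot_cvg.
move=> Q AQ; split=> [Qinv|[T [Y [Yinv [[[Td Tdef] TP] Tm YY AT]]]]].
  have Q0 : op_ge0 Q.
    by apply: (wot_op_ge0 _ (sot_wot AQ)) => k; exact: iter_Phi_ge0.
  have [T [Y [Yinv [Td T1 YYi TA AT]]]] :=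
    fixed_similar a_ge0 A_cvg Q0 Qinv (Phi_limit_fixed a_ge0 A_cvg AQ Qinv).
  have T0 s : (0 < s)%N -> defect a T s = 0.
    case: s => [//|s] _; elim: s => [|s IH]; first by rewrite /defect /= T1 subrr.
    rewrite [LHS](_ : _ = defect a T s.+1 - Phi a T (defect a T s.+1)) //.
    by rewrite IH Phi0 // subrr.
  exists T, Y, Yinv; split=> //; [|exact: T0|by case: YYi].
  split; first split=> // s /andP[s0 _]; first by rewrite T0 //; exact: op_ge0_0.
  by move=> p /A_P pA; rewrite (nc_eval_conj p YYi TA) pA mulr0 mul0r.
apply: (similar_fixed_invertible a_ge0 A_cvg Td AQ YY AT).
case: m m_gt0 Tdef Tm => [//|m] _ Tdef Tm.
apply: (defect_eq0_fixed a_ge0 Td _ Tm) => -[|s] sm; first exact: op_ge0_1.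
by apply: Tdef; rewrite /= (leq_trans sm).
Qed.
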